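(* Let $\beta\ge\bar\beta$ and let $X^*\in\Omega$ satisfy $\nabla h(X^* )=0$. Then either $(X^* )^\top X^*=I_p$ and $X^*$ is a first-order stationary point of (OCP), or $\sigma_{\min}(X^* )\le\sqrt{2M_1/\beta}$.
   Context: $f:\mathbb{R}^{n\times p}\to\mathbb{R}$ ($n\ge p$) is differentiable with $f$ and $\nabla f$ locally Lipschitz. (OCP) is the problem $\min f(X)$ s.t. $X^\top X=I_p$; the feasible set is the Stiefel manifold $\mathcal{S}_{n,p}=\{X:X^\top X=I_p\}$. $\Phi(M):=\frac12(M+M^\top)$. A point $X\in\mathcal{S}_{n,p}$ is a first-order stationary point of (OCP) if $\mathrm{grad} f(X):=\nabla f(X)-X\Phi(X^\top\nabla f(X))=0$. $\mathcal{A}(X):=\frac32I_p-\frac12X^\top X$, $g(X):=f(X\mathcal{A}(X))$, $h(X):=g(X)+\frac\beta4\|X^\top X-I_p\|_F^2$ with $\beta>0$, $G(X):=\nabla f(Y)|_{Y=X\mathcal{A}(X)}$. $\sigma_{\min}$ denotes the smallest singular value. $\Omega:=\{X:\|X\|_2\le 1+\frac1{12}\}$ ($\|\cdot\|_2$ spectral norm). $M_1:=\sup_{X\in\Omega}\|G(X)\|_F$, $M_2:=\sup_{X\ne Y\in\Omega}\frac{\|\nabla g(X)-\nabla g(Y)\|_F}{\|X-Y\|_F}$, $\bar\beta:=\max\{12M_1,6M_2\}$. *)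

(* Defs.v *)
From HB Require Import structures.
From mathcomp Require Import all_boot all_order all_algebra.
From mathcomp Require Import all_classical all_reals all_analysis.
Set Implicit Arguments. Unset Strict Implicit. Unset Printing Implicit Defensive.
Import Order.TTheory GRing.Theory Num.Theory.
Import numFieldNormedType.Exports.
Local Open Scope ring_scope.
Local Open Scope classical_set_scope.

Section Defs.
Variable R : realType.

Definition frob m n (X : 'M[R]_(m, n)) : R :=
  Num.sqrt (\sum_(i < m) \sum_(j < n) X i j ^+ 2).

(* Euclidean gradient (w.r.t. the Frobenius inner product) of a
   (Frechet-)differentiable F : R^{n x p} -> R : the matrix of partial
   derivatives, (grad F X)_{ij} = dF(X)[E_ij]. *)
Definition mgrad n p (F : 'M[R]_(n, p) -> R) (X : 'M[R]_(n, p)) : 'M[R]_(n, p) :=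
  \matrix_(i, j) ('d F X (delta_mx i j : 'M[R]_(n, p))).

Definition symPhi p (M : 'M[R]_p) : 'M[R]_p := 2^-1 *: (M + M^T).

(* Riemannian gradient on the Stiefel manifold *)
Definition gradOCP n p (f : 'M[R]_(n, p) -> R) (X : 'M[R]_(n, p)) : 'M[R]_(n, p) :=
  mgrad f X - X *m symPhi (X^T *m mgrad f X).

Definition Amap n p (X : 'M[R]_(n, p)) : 'M[R]_p :=
  (3 / 2 : R)%:M - 2^-1 *: (X^T *m X).

Definition gfun n p (f : 'M[R]_(n, p) -> R) (X : 'M[R]_(n, p)) : R :=
  f (X *m Amap X).

Definition hfun n p (f : 'M[R]_(n, p) -> R) (beta : R) (X : 'M[R]_(n, p)) : R :=
  gfun f X + beta / 4 * frob (X^T *m X - 1%:M) ^+ 2.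

Definition Gfun n p (f : 'M[R]_(n, p) -> R) (X : 'M[R]_(n, p)) : 'M[R]_(n, p) :=
  mgrad f (X *m Amap X).

(* singular values of X (n >= p): square roots of the eigenvalues of X^T X *)
Definition singvals n p (X : 'M[R]_(n, p)) : set R :=
  [set s | exists2 l, eigenvalue (X^T *m X) l & s = Num.sqrt l].

Definition sigma_min n p (X : 'M[R]_(n, p)) : R := inf (singvals X).
Definition sigma_max n p (X : 'M[R]_(n, p)) : R := sup (singvals X).

Definition spec_norm n p (X : 'M[R]_(n, p)) : R := sigma_max X.

Definition Omega n p : set 'M[R]_(n, p) :=
  [set X | spec_norm X <= 1 + 12^-1].

Definition locLip_real n p (F : 'M[R]_(n, p) -> R) : Prop :=
  forall X, exists2 r : R, 0 < r & exists L : R, forall Y Z,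
    frob (Y - X) < r -> frob (Z - X) < r -> `|F Y - F Z| <= L * frob (Y - Z).

Definition locLip_mx n p (F : 'M[R]_(n, p) -> 'M[R]_(n, p)) : Prop :=
  forall X, exists2 r : R, 0 < r & exists L : R, forall Y Z,
    frob (Y - X) < r -> frob (Z - X) < r -> frob (F Y - F Z) <= L * frob (Y - Z).

Definition M1 n p (f : 'M[R]_(n, p) -> R) : R :=
  sup [set frob (Gfun f X) | X in @Omega n p].

Definition M2 n p (f : 'M[R]_(n, p) -> R) : R :=
  sup [set r | exists X Y, [/\ @Omega n p X, @Omega n p Y, X <> Y &
     r = frob (mgrad (gfun f) X - mgrad (gfun f) Y) / frob (X - Y)]].

Definition betabar n p (f : 'M[R]_(n, p) -> R) : R :=
  Num.max (12 * M1 f) (6 * M2 f).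

End Defs.
Arguments Omega {R} n p.

(* Main.v *)
(* Write S = X^T X and G = G(X). Then
     grad h(X) = G A(X) - X Phi(X^T G) + beta X (S - 1),
   and pairing this with X (S - 1) gives, at a critical point,
     beta |X (S - 1)|^2 = 3/2 <G (S - 1), X (S - 1)>.
   The left side is at least beta sigma_min(X)^2 |S - 1|^2 and, for X in Omega,
   the right side is at most 3/2 * 13/12 * M_1 |S - 1|^2. So S = 1 as soon as
   beta sigma_min(X)^2 > 2 M_1; then A(X) = 1 and grad h(X) is the Riemannian
   gradient of f at X. M_1 is finite because a locally Lipschitz map is bounded
   on bounded sets. *)
Require Import Defs.
From HB Require Import structures.
From mathcomp Require Import all_boot all_order all_algebra.
From mathcomp Require Import all_classical all_reals all_analysis.
From mathcomp Require Import ring lra.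
Import Order.TTheory GRing.Theory Num.Theory.
Import numFieldNormedType.Exports.
Local Open Scope ring_scope.
Local Open Scope classical_set_scope.

Set Implicit Arguments.
Unset Strict Implicit.

(** * Cauchy-Schwarz from the sign of a discriminant *)

(** For [c > 0], evaluate at the minimiser [t = - (b / c)]; for [c = 0] the expression is affine in
    [t], which forces [b = 0]. *)
Lemma discriminant_le (R : realFieldType) (a b c : R) :
  0 <= c -> (forall t, 0 <= a + t * b *+ 2 + t ^+ 2 * c) -> b ^+ 2 <= a * c.
Proof.
move=> c0 h; have [c_eq0|cN0] := eqVneq c 0; last first.
  have c_gt0 : 0 < c by rewrite lt0r cN0.
  have := h (- (b / c)); rewrite (_ : _ + _ = (a * c - b ^+ 2) / c); last by field.
  by rewrite pmulr_lge0 ?invr_gt0// subr_ge0.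
rewrite c_eq0 mulr0; move: h; rewrite c_eq0 => h.
have [->|bN0] := eqVneq b 0; first by rewrite expr0n.
(* At this [t] the affine function takes the value -1. *)
have := h (- ((a + 1) / (2 * b))).
rewrite (_ : _ + _ = -1); first by rewrite ler0N1.
by field.
Qed.

(** The sum over [i] of [(a i + t * b i) ^+ 2] is a nonnegative quadratic in [t]. *)
Lemma sum_cauchy_schwarz (R : realFieldType) (I : finType) (a b : I -> R) :
  (\sum_i a i * b i) ^+ 2 <= (\sum_i a i ^+ 2) * (\sum_i b i ^+ 2).
Proof.
apply: discriminant_le => [|t]; first by apply: sumr_ge0 => i _; exact: sqr_ge0.
rewrite mulr_sumr -sumrMnl mulr_sumr -!big_split /=.
apply: sumr_ge0 => i _; rewrite (_ : _ + _ = (a i + t * b i) ^+ 2) ?sqr_ge0//.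
by ring.
Qed.

(** * The Frobenius inner product and norm, and the least eigenvalue of a symmetric matrix *)

Section frobenius.
Variable R : realType.

(** The Frobenius inner product; in trace form, moving a factor across it is mere associativity. *)
Definition mxdot m n (A B : 'M[R]_(m, n)) : R := \tr (A^T *m B).

Lemma mxdotE m n (A B : 'M[R]_(m, n)) :
  mxdot A B = \sum_(ij : 'I_m * 'I_n) A ij.1 ij.2 * B ij.1 ij.2.
Proof.
rewrite -(pair_bigA _ (fun i j => A i j * B i j)) exchange_big /=.
by apply: eq_bigr => j _; rewrite mxE; apply: eq_bigr => i _; rewrite mxE.
Qed.

Lemma mxdotC m n (A B : 'M[R]_(m, n)) : mxdot A B = mxdot B A.
Proof. by rewrite !mxdotE; apply: eq_bigr => ij _; rewrite mulrC. Qed.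

Lemma mxdotDl m n (A B C : 'M[R]_(m, n)) :
  mxdot (A + B) C = mxdot A C + mxdot B C.
Proof. by rewrite /mxdot linearD mulmxDl mxtraceD. Qed.

Lemma mxdotDr m n (A B C : 'M[R]_(m, n)) :
  mxdot A (B + C) = mxdot A B + mxdot A C.
Proof. by rewrite /mxdot mulmxDr mxtraceD. Qed.

Lemma mxdotZl m n a (A B : 'M[R]_(m, n)) : mxdot (a *: A) B = a * mxdot A B.
Proof. by rewrite /mxdot linearZ -scalemxAl mxtraceZ. Qed.

Lemma mxdotZr m n a (A B : 'M[R]_(m, n)) : mxdot A (a *: B) = a * mxdot A B.
Proof. by rewrite mxdotC mxdotZl mxdotC. Qed.

Lemma mxdotNl m n (A B : 'M[R]_(m, n)) : mxdot (- A) B = - mxdot A B.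
Proof. by rewrite -scaleN1r mxdotZl mulN1r. Qed.

Lemma mxdotNr m n (A B : 'M[R]_(m, n)) : mxdot A (- B) = - mxdot A B.
Proof. by rewrite mxdotC mxdotNl mxdotC. Qed.

Lemma mxdotBl m n (A B C : 'M[R]_(m, n)) :
  mxdot (A - B) C = mxdot A C - mxdot B C.
Proof. by rewrite mxdotDl mxdotNl. Qed.

Lemma mxdotBr m n (A B C : 'M[R]_(m, n)) :
  mxdot A (B - C) = mxdot A B - mxdot A C.
Proof. by rewrite mxdotDr mxdotNr. Qed.

Lemma mxdot0l m n (A : 'M[R]_(m, n)) : mxdot 0 A = 0.
Proof. by rewrite -(scale0r A) mxdotZl mul0r. Qed.

Lemma mxdot_tr m n (A B : 'M[R]_(m, n)) : mxdot A^T B^T = mxdot A B.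
Proof. by rewrite /mxdot trmxK mxtrace_mulC -mxtrace_tr trmx_mul trmxK. Qed.

Lemma mxdot_mulmxl m n k (A : 'M[R]_(m, n)) (B : 'M[R]_(n, k)) (C : 'M[R]_(m, k)) :
  mxdot (A *m B) C = mxdot B (A^T *m C).
Proof. by rewrite /mxdot trmx_mul mulmxA. Qed.

Lemma mxdot_mulmxr m n k (A : 'M[R]_(m, n)) (B : 'M[R]_(n, k)) (C : 'M[R]_(m, k)) :
  mxdot (A *m B) C = mxdot A (C *m B^T).
Proof. by rewrite -mxdot_tr trmx_mul mxdot_mulmxl -[LHS]mxdot_tr trmx_mul !trmxK. Qed.

Lemma mxdot_delta m n (A : 'M[R]_(m, n)) i j : mxdot A (delta_mx i j) = A i j.
Proof.
rewrite mxdotE (bigD1 (i, j)) //= mxE !eqxx mulr1 big1 ?addr0//.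
by move=> [k l] /=; rewrite mxE xpair_eqE => /negbTE ->; rewrite mulr0.
Qed.

Lemma frob_ge0 m n (A : 'M[R]_(m, n)) : 0 <= frob A.
Proof. exact: sqrtr_ge0. Qed.

Lemma frob_sqr m n (A : 'M[R]_(m, n)) : frob A ^+ 2 = mxdot A A.
Proof.
rewrite sqr_sqrtr; last first.
  by apply: sumr_ge0 => i _; apply: sumr_ge0 => j _; exact: sqr_ge0.
rewrite mxdotE -(pair_bigA _ (fun i j => A i j * A i j)) /=.
by apply: eq_bigr => i _; apply: eq_bigr => j _; rewrite expr2.
Qed.

Lemma frob_sqrE m n (A : 'M[R]_(m, n)) :
  frob A ^+ 2 = \sum_(ij : 'I_m * 'I_n) A ij.1 ij.2 ^+ 2.
Proof. by rewrite frob_sqr mxdotE. Qed.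

Lemma frob_eq0 m n (A : 'M[R]_(m, n)) : frob A = 0 -> A = 0.
Proof.
move=> A0; apply/matrixP => i j; rewrite mxE; apply/eqP.
have := frob_sqrE A; rewrite A0 expr0n /= => /esym/eqP.
rewrite psumr_eq0 => [|ij _]; last exact: sqr_ge0.
by move=> /allP /(_ (i, j) (mem_index_enum _)) /=; rewrite sqrf_eq0.
Qed.

Lemma mxdot_gt0 m n (A : 'M[R]_(m, n)) : A != 0 -> 0 < mxdot A A.
Proof.
move=> A0; rewrite -frob_sqr exprn_gt0// lt0r frob_ge0 andbT.
by apply: contra A0 => /eqP /frob_eq0 ->.
Qed.

Lemma mxdot_cauchy_schwarz m n (A B : 'M[R]_(m, n)) :
  `|mxdot A B| <= frob A * frob B.
Proof.
rewrite -(ler_pXn2r (n := 2))// ?nnegrE ?mulr_ge0 ?frob_ge0//.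
by rewrite real_normK ?num_real// exprMn !frob_sqrE mxdotE sum_cauchy_schwarz.
Qed.

Lemma mxdot_le m n (A B : 'M[R]_(m, n)) : mxdot A B <= frob A * frob B.
Proof. exact: le_trans (ler_norm _) (mxdot_cauchy_schwarz A B). Qed.

Lemma frobD m n (A B : 'M[R]_(m, n)) : frob (A + B) <= frob A + frob B.
Proof.
rewrite -(ler_pXn2r (n := 2))// ?nnegrE ?addr_ge0 ?frob_ge0//.
rewrite sqrrD !frob_sqr mxdotDl !mxdotDr (mxdotC B A).
have := mxdot_le A B; lra.
Qed.

Lemma frobZ m n a (A : 'M[R]_(m, n)) : frob (a *: A) = `|a| * frob A.
Proof.
apply/eqP; rewrite -(eqrXn2 (n := 2))// ?mulr_ge0 ?frob_ge0//.
by rewrite exprMn real_normK ?num_real// !frob_sqr mxdotZl mxdotZr mulrA expr2.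
Qed.

Lemma frobN m n (A : 'M[R]_(m, n)) : frob (- A) = frob A.
Proof. by rewrite -scaleN1r frobZ normrN1 mul1r. Qed.

Lemma frobB m n (A B : 'M[R]_(m, n)) : frob (A - B) <= frob A + frob B.
Proof. by rewrite -(frobN B) frobD. Qed.

Lemma frob_tr m n (A : 'M[R]_(m, n)) : frob A^T = frob A.
Proof.
by apply/eqP; rewrite -(eqrXn2 (n := 2))// ?frob_ge0// !frob_sqr mxdot_tr.
Qed.

(** Cauchy-Schwarz bounds each entry of the product, a row of [A] against a column of [B]; then sum
    the squares. *)
Lemma frobM m n k (A : 'M[R]_(m, n)) (B : 'M[R]_(n, k)) :
  frob (A *m B) <= frob A * frob B.
Proof.
rewrite -(ler_pXn2r (n := 2))// ?nnegrE ?mulr_ge0 ?frob_ge0// exprMn.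
rewrite -(frob_tr B) !frob_sqrE.
rewrite -(pair_bigA _ (fun i j => A i j ^+ 2)).
rewrite -(pair_bigA _ (fun i j => (B^T) i j ^+ 2)) /=.
rewrite -(pair_bigA _ (fun i j => (A *m B) i j ^+ 2)) /=.
rewrite mulr_suml; apply: ler_sum => i _; rewrite mulr_sumr; apply: ler_sum => j _.
rewrite mxE (le_trans (sum_cauchy_schwarz (A i) (B^~ j)))//.
rewrite ler_wpM2l//; first by apply: sumr_ge0 => l _; exact: sqr_ge0.
by apply: ler_sum => l _; rewrite mxE.
Qed.

(* The extreme value is the supremum of the r such that S - r is positive
   semidefinite; were S - r invertible at the supremum, the Cauchy-Schwarz
   inequality for that form would make it coercive, and r could be increased. *)
Lemma symmetric_min_eigenvalue p (S : 'M[R]_p) : (0 < p)%N -> S^T = S ->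
  exists2 l, eigenvalue S l &
    forall v : 'rV_p, l * mxdot v v <= mxdot v (v *m S).
Proof.
move=> p0 symS.
pose E := [set r : R | forall v : 'rV_p, r * mxdot v v <= mxdot v (v *m S)].
pose e : 'rV[R]_p := delta_mx 0 (Ordinal p0).
have e0 : e != 0.
  apply/eqP => /matrixP /(_ 0 (Ordinal p0)); rewrite !mxE !eqxx /=.
  by move/eqP; rewrite oner_eq0.
have ubE (v : 'rV[R]_p) : v != 0 -> ubound E (mxdot v (v *m S) / mxdot v v).
  by move=> v0 r Er; rewrite ler_pdivlMr ?mxdot_gt0//; exact: (Er v).
have E0 : E !=set0.
  exists (- frob S) => v; rewrite mulNr lerNl -mxdotNr.
  apply: le_trans (mxdot_le _ _) _; rewrite frobN -frob_sqr mulrC expr2 mulrA.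
  by rewrite ler_wpM2r ?frob_ge0// mulrC frobM.
have supE : has_sup E by split => //; eexists; exact: (ubE e).
pose l := sup E.
have El : E l.
  move=> v; have [->|v0] := eqVneq v 0; first by rewrite !mxdot0l mulr0.
  by rewrite -ler_pdivlMr ?mxdot_gt0//; apply: ge_sup => //; exact: ubE.
exists l => //; rewrite /eigenvalue /eigenspace kermx_eq0 row_free_unit.
apply/negP => uB; set B := S - l%:M in uB.
have symB : B^T = B by rewrite linearB /= symS tr_scalar_mx.
pose b (x y : 'rV_p) := mxdot x (y *m B).
have b_ge0 x : 0 <= b x x.
  by rewrite /b mulmxBr mul_mx_scalar mxdotBr mxdotZr subr_ge0; exact: (El x).
have bC x y : b x y = b y x by rewrite /b mxdotC mxdot_mulmxr symB.
pose C := frob (invmx B) + 1.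
have C0 : 0 < C by rewrite ltr_wpDl ?frob_ge0.
suff : l + C^-1 <= l by rewrite -subr_ge0 opprD addNKr oppr_ge0 leNgt invr_gt0 C0.
apply: ub_le_sup; first exact: supE.2.
move=> x; rewrite mulrDl -lerBrDl.
rewrite -(mxdotZr l) -mul_mx_scalar -mxdotBr -mulmxBr -/B -/(b x x).
have [->|x0] := eqVneq x 0; first by rewrite /b !mxdot0l mulr0.
rewrite mulrC ler_pdivrMr//.
(* For this [y], [b x y] is [mxdot x x] and [b y y] is at most [C * mxdot x x], so Cauchy-Schwarz
   for [b] gives [mxdot x x <= C * b x x]. *)
pose y := x *m invmx B.
have yB : y *m B = x by rewrite /y -mulmxA mulVmx// mulmx1.
have bxy : b x y = mxdot x x by rewrite /b yB.
have byy : b y y <= C * mxdot x x.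
  rewrite /b yB -frob_sqr (le_trans (mxdot_le _ _))// expr2 mulrA.
  rewrite ler_wpM2r ?frob_ge0// (le_trans (frobM _ _))// mulrC.
  by rewrite ler_wpM2r ?frob_ge0// lerDl.
have : b x y ^+ 2 <= b x x * b y y.
  apply: discriminant_le => // t; have := b_ge0 (x + t *: y).
  rewrite {1}/b mulmxDl mxdotDl !mxdotDr -scalemxAl !mxdotZl !mxdotZr.
  rewrite -!/(b _ _) (bC y x); congr (_ <= _); ring.
rewrite bxy => h; rewrite -(ler_pM2r (mxdot_gt0 x0)) -expr2 (le_trans h)//.
by rewrite -mulrA ler_wpM2l.
Qed.

End frobenius.

(** * Derivatives from quadratic remainder bounds *)

Section differentiation.
Variable R : realType.

(** A quadratic remainder is little-o of the increment, and a bounded linear map is continuous, so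
    uniqueness of the differential identifies it with [L]. *)
Lemma diff_quadratic_remainder (V W : normedModType R) (F L : V -> W) (x : V)
    (K C : R) :
  linear L -> (forall v, `|L v| <= K * `|v|) ->
  (forall v, `|v| <= 1 -> `|F (v + x) - F x - L v| <= C * `|v| ^+ 2) ->
  differentiable F x /\ 'd F x = L :> (V -> W).
Proof.
move=> linL LK FC.
pose Lf : {linear V -> W} := HB.pack L (GRing.isLinear.Build _ _ _ _ _ linL).
have cL : continuous Lf.
  apply/linear_bounded_continuous/linear_boundedP.
  near=> k => v; apply: le_trans (LK v) _.
  by rewrite ler_wpM2r//; near: k; exact: nbhs_pinfty_ge.
have oL : F \o shift x = cst (F x) + Lf +o_ 0 id.
  apply/eqaddoP => e e0; near=> v; rewrite /=.
  rewrite [X in `|X| <= _](_ : _ = F (v + x) - F x - L v); last first.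
    by rewrite !fctE /= opprD addrA.
  have v1 : `|v| <= 1 by near: v; exact: nbhs0_le.
  apply: le_trans (FC v v1) _; rewrite expr2 mulrA ler_wpM2r//.
  apply: (@le_trans _ _ ((`|C| + 1) * `|v|)).
    by rewrite ler_wpM2r// (le_trans (ler_norm C))// lerDl.
  rewrite mulrC -ler_pdivlMr ?ltr_wpDl//.
  by near: v; apply: nbhs0_le; rewrite divr_gt0// ltr_wpDl.
have dL := diff_unique cL oL.
split; last by rewrite dL.
by apply/diff_locallyP; rewrite dL.
Unshelve. all: by end_near. Qed.

(** Differentiability refers to the norm given by the largest absolute entry; this and the next two
    lemmas compare that norm with [frob]. *)
Lemma mx_norm_ge m n (A : 'M[R]_(m, n)) i j : `|A i j| <= `|A|.
Proof.
by rewrite [leRHS]/Num.Def.normr /= mx_normrE; apply/bigmax_geP; right; exists (i, j).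
Qed.

Lemma mx_norm_le_frob m n (A : 'M[R]_(m, n)) : `|A| <= frob A.
Proof.
rewrite [leLHS]/Num.Def.normr /= mx_normrE; apply: bigmax_le => [|[i j] _ /=].
  exact: frob_ge0.
rewrite -(ler_pXn2r (n := 2))// ?nnegrE ?frob_ge0//.
rewrite real_normK ?num_real// frob_sqrE (bigD1 (i, j)) //= lerDl.
by apply: sumr_ge0 => ? _; exact: sqr_ge0.
Qed.

Lemma frob_le_mx_norm m n (A : 'M[R]_(m, n)) : frob A <= (m * n)%:R * `|A|.
Proof.
rewrite -(ler_pXn2r (n := 2))// ?nnegrE ?frob_ge0 ?mulr_ge0//.
rewrite frob_sqrE exprMn; apply: (@le_trans _ _ ((m * n)%:R * `|A| ^+ 2)).
  apply: (@le_trans _ _ (\sum_(ij : 'I_m * 'I_n) `|A| ^+ 2)).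
    apply: ler_sum => -[i j] _ /=; rewrite -[leLHS]real_normK ?num_real//.
    by rewrite ler_pXn2r ?nnegrE// mx_norm_ge.
  by rewrite sumr_const card_prod !card_ord mulr_natl.
rewrite ler_wpM2r ?sqr_ge0// -natrX ler_nat.
by case: (m * n)%N => // k; rewrite leq_pmulr.
Qed.

(** The factor [(1 + frob D) ^+ 2] leaves room for the cubic and quartic terms of polynomial maps;
    it stays bounded for small [D]. *)
Lemma mx_diff_quadratic_remainder m n (W : normedModType R)
    (F L : 'M[R]_(m, n) -> W) (X : 'M[R]_(m, n)) (K C : R) :
  linear L -> 0 <= K -> 0 <= C -> (forall D, `|L D| <= K * frob D) ->
  (forall D, `|F (D + X) - F X - L D| <= C * (1 + frob D) ^+ 2 * frob D ^+ 2) ->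
  differentiable F X /\ 'd F X = L :> (_ -> _).
Proof.
move=> linL K0 C0 LK FC; set k := (m * n)%:R : R.
apply: (@diff_quadratic_remainder _ _ F L X (K * k) (C * (1 + k) ^+ 2 * k ^+ 2)) => //.
  by move=> D; rewrite (le_trans (LK D))// -mulrA ler_wpM2l// frob_le_mx_norm.
move=> D D1; apply: le_trans (FC D) _; rewrite -[leRHS]mulrA -exprMn.
have fD := frob_le_mx_norm D.
have k0 : 0 <= k by [].
apply: ler_pM.
- by rewrite mulr_ge0 ?sqr_ge0.
- exact: sqr_ge0.
- rewrite ler_wpM2l// ler_pXn2r// ?nnegrE ?addr_ge0 ?frob_ge0//.
  by rewrite lerD2l (le_trans fD)// ler_piMr.
- by rewrite ler_pXn2r// nnegrE ?frob_ge0// mulr_ge0.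
Qed.

(** By linearity of the differential, after expanding [D] in the elementary matrices. *)
Lemma diff_mgrad m n (F : 'M[R]_(m, n) -> R) X D :
  'd F X D = mxdot (mgrad F X) D.
Proof.
rewrite [in LHS](matrix_sum_delta D) mxdotE raddf_sum /=.
rewrite -(pair_bigA _ (fun i j => mgrad F X i j * D i j)) /=.
apply: eq_bigr => i _; rewrite raddf_sum /=; apply: eq_bigr => j _.
by rewrite linearZ mxE mulrC.
Qed.

(** * The gradient of [hfun] *)

Section gradient.
Variables n p : nat.
Implicit Types X D : 'M[R]_(n, p).

Lemma mxdot_symPhi (M N : 'M[R]_p) : mxdot (symPhi M) N = mxdot M (symPhi N).
Proof.
by rewrite /symPhi mxdotZl mxdotZr mxdotDl mxdotDr -(mxdot_tr M^T) trmxK.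
Qed.

Lemma symPhi_linear : linear (@symPhi R p).
Proof. by move=> a M N; apply/matrixP => i j; rewrite !mxE; ring. Qed.

(** The differential of [Y *m Amap Y] at [X] in direction [D], by the product rule. *)
Let L X D := D *m Amap X - X *m symPhi (X^T *m D).

Let linL X : linear (L X).
Proof.
move=> a D E; rewrite /L (mulmxDl (a *: D)) -(scalemxAl a D).
rewrite (mulmxDr X^T) -(scalemxAr a X^T) symPhi_linear.
by rewrite (mulmxDr X) -(scalemxAr a X) scalerBr opprD addrACA.
Qed.

Lemma tr_Amap X : (Amap X)^T = Amap X.
Proof. by rewrite /Amap linearB linearZ /= trmx_mul trmxK tr_scalar_mx. Qed.

Lemma diff_XA X : differentiable (fun Y => Y *m Amap Y) X /\
  'd (fun Y => Y *m Amap Y) X = L X :> (_ -> _).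
Proof.
apply: (@mx_diff_quadratic_remainder _ _ _ _ _ X
  (frob (Amap X) + frob X ^+ 2) (frob X *+ 2 + 1)).
- exact: linL.
- by rewrite addr_ge0 ?frob_ge0 ?sqr_ge0.
- by rewrite addr_ge0 ?mulrn_wge0 ?frob_ge0.
- move=> D; apply: le_trans (mx_norm_le_frob _) _; rewrite mulrDl.
  apply: le_trans (frobB _ _) _; apply: lerD.
    by rewrite mulrC frobM.
  rewrite expr2 -mulrA; apply: le_trans (frobM _ _) _; rewrite ler_wpM2l ?frob_ge0//.
  rewrite frobZ gtr0_norm ?invr_gt0// ler_pdivrMl//.
  apply: le_trans (frobD _ _) _; rewrite frob_tr.
  by have := frobM X^T D; rewrite frob_tr; lra.
move=> D; apply: le_trans (mx_norm_le_frob _) _.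
(* The map is a cubic polynomial; removing the constant and linear parts leaves exactly the terms of
   degree two and three in [D]. *)
rewrite (_ : _ - _ = - 2^-1 *: (X *m (D^T *m D) +
    D *m (D^T *m X + X^T *m D) + D *m (D^T *m D))); last first.
  have trD : (D + X)^T = D^T + X^T by rewrite linearD.
  rewrite /L /Amap /symPhi trmx_mul trmxK trD.
  rewrite !(mulmxDl, mulmxDr, mulmxN, =^~ scalemxAr, mul_mx_scalar) !mulmxA.
  move: (X *m D^T *m D) (D *m D^T *m X) (X *m D^T *m X) (D *m D^T *m D)
    (X *m X^T *m X) (X *m X^T *m D) (D *m X^T *m X) (D *m X^T *m D) => *.
  by apply/matrixP => i j; rewrite !mxE; field.
rewrite frobZ normrN gtr0_norm ?invr_gt0//.
set x := frob X; set d := frob D.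
have [x0 d0] : 0 <= x /\ 0 <= d by split; exact: frob_ge0.
have h1 : frob (X *m (D^T *m D)) <= x * (d * d).
  by rewrite (le_trans (frobM _ _))// ler_wpM2l// (le_trans (frobM _ _))// frob_tr.
have h2 : frob (D *m (D^T *m X + X^T *m D)) <= d * (d * x + x * d).
  rewrite (le_trans (frobM _ _))// ler_wpM2l// (le_trans (frobD _ _))// lerD//.
    by rewrite (le_trans (frobM _ _))// frob_tr.
  by rewrite (le_trans (frobM _ _))// frob_tr.
have h3 : frob (D *m (D^T *m D)) <= d * (d * d).
  by rewrite (le_trans (frobM _ _))// ler_wpM2l// (le_trans (frobM _ _))// frob_tr.
have := frobD (X *m (D^T *m D) + D *m (D^T *m X + X^T *m D)) (D *m (D^T *m D)).
have := frobD (X *m (D^T *m D)) (D *m (D^T *m X + X^T *m D)).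
set u := frob (_ + _ + _); set v := frob (_ + _) => h4 h5.
have h6 : u <= x * d ^+ 2 * 3 + d ^+ 3 by nra.
apply: (@le_trans _ _ (2^-1 * (x * d ^+ 2 * 3 + d ^+ 3))); first by rewrite ler_wpM2l.
(* The facts below give the signs of the monomials in the expansion of [(2x + 1)(1 + d)^2 d^2],
   which makes the comparison linear. *)
rewrite (mulr2n x).
have : 0 <= d ^+ 2 * x by rewrite mulr_ge0 ?sqr_ge0.
have : 0 <= d ^+ 3 by rewrite exprn_ge0.
have : 0 <= d ^+ 3 * x by rewrite mulr_ge0 ?exprn_ge0.
have : 0 <= d ^+ 4 by rewrite exprn_ge0.
have : 0 <= d ^+ 4 * x by rewrite mulr_ge0 ?exprn_ge0.
have : 0 <= d ^+ 2 by rewrite exprn_ge0.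
lra.
Qed.

Let penalty X := frob (X^T *m X - 1%:M) ^+ 2.

(** The increment of [N = X^T X - 1] is [E + Q], linear plus quadratic in [D]. Expanding the square,
    [2 <N, E>] is the derivative, since [N] is symmetric, and [2 <N, Q> + |E + Q|^2] is the
    remainder. *)
Lemma diff_penalty X : differentiable penalty X /\
  'd penalty X = (fun D => 4 * mxdot (X *m (X^T *m X - 1%:M)) D) :> (_ -> _).
Proof.
pose N := X^T *m X - 1%:M.
have symN : N^T = N by rewrite linearB /= trmx_mul trmxK trmx1.
apply: (@mx_diff_quadratic_remainder _ _ _ _ _ X (4 * frob (X *m N))
  (frob N * 2 + 4 * (frob X + 1) ^+ 2)).
- by move=> a D E; rewrite mxdotDr mxdotZr mulrDr mulrCA.
- by rewrite mulr_ge0 ?frob_ge0.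
- by apply: addr_ge0; apply: mulr_ge0 => //; rewrite ?frob_ge0 ?sqr_ge0.
- by move=> D; rewrite normrM ger0_norm// -mulrA ler_wpM2l// mxdot_cauchy_schwarz.
move=> D; pose E := D^T *m X + X^T *m D; pose Q := D^T *m D.
have DXN : (D + X)^T *m (D + X) - 1%:M = N + (E + Q).
  have trD : (D + X)^T = D^T + X^T by rewrite linearD.
  rewrite trD !(mulmxDl, mulmxDr) /N /E /Q.
  move: (D^T *m D) (D^T *m X) (X^T *m D) (X^T *m X) 1%:M => *.
  by apply/matrixP => i j; rewrite !mxE; ring.
have NE : mxdot N E = 2 * mxdot (X *m N) D.
  rewrite mxdotDr -[X in X + _]mxdot_tr symN trmx_mul trmxK.
  by rewrite mxdot_mulmxl mulr2n mulrDl !mul1r.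
rewrite /penalty DXN -/N (frob_sqr N) (frob_sqr (N + _)).
rewrite (_ : _ - _ = 2 * mxdot N Q + mxdot (E + Q) (E + Q)); last first.
  rewrite (mxdotDl N) (mxdotDr N N) (mxdotDr (E + Q) N) (mxdotC (E + Q) N).
  by rewrite (mxdotDr N E) NE; ring.
rewrite -frob_sqr; apply: le_trans (ler_normD _ _) _.
rewrite normrM (ger0_norm (_ : 0 <= 2))// (ger0_norm (sqr_ge0 _)).
set x := frob X; set d := frob D.
have [x0 d0] : 0 <= x /\ 0 <= d by split; exact: frob_ge0.
have hQ : frob Q <= d * d by rewrite (le_trans (frobM _ _))// frob_tr.
have hE : frob E <= 2 * x * d.
  rewrite (le_trans (frobD _ _))//.
  have := frobM D^T X; have := frobM X^T D; rewrite !frob_tr -/x -/d; lra.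
have hEQ : frob (E + Q) <= 2 * (x + 1) * (1 + d) * d.
  by rewrite (le_trans (frobD _ _))//; nra.
have hNQ : `|mxdot N Q| <= frob N * d ^+ 2.
  by rewrite (le_trans (mxdot_cauchy_schwarz _ _))// ler_wpM2l ?frob_ge0.
have hEQ2 : frob (E + Q) ^+ 2 <= (2 * (x + 1) * (1 + d) * d) ^+ 2.
  by rewrite ler_pXn2r ?nnegrE ?frob_ge0// !mulr_ge0 ?addr_ge0.
have hN : frob N * d ^+ 2 <= frob N * d ^+ 2 * (1 + d) ^+ 2.
  rewrite ler_peMr ?mulr_ge0 ?sqr_ge0 ?frob_ge0//.
  by rewrite exprn_ege1// lerDl.
apply: (@le_trans _ _ (2 * (frob N * d ^+ 2 * (1 + d) ^+ 2)
  + (2 * (x + 1) * (1 + d) * d) ^+ 2)).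
  lra.
by rewrite le_eqVlt; apply/orP; left; apply/eqP; ring.
Qed.

(** The chain rule pairs [Gfun f X] with [L X D]. Taking adjoints, with [Amap X] symmetric and
    [symPhi] self-adjoint, isolates [D]; the 4 from the penalty cancels [beta / 4]. *)
Lemma mgrad_hfun (f : 'M[R]_(n, p) -> R) beta X :
  (forall Y, differentiable f Y) ->
  mgrad (hfun f beta) X = Gfun f X *m Amap X
    - X *m symPhi (X^T *m Gfun f X) + beta *: (X *m (X^T *m X - 1%:M)).
Proof.
move=> df.
have [dXA eXA] := diff_XA X; have [dP eP] := diff_penalty X.
have dg : differentiable (gfun f) X by exact: differentiable_comp.
have eg : 'd (gfun f) X = (fun D => mxdot (Gfun f X) (L X D)) :> (_ -> _).
  apply/funext => D; rewrite -diff_mgrad -eXA.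
  by rewrite (diff_comp dXA (df _)).
have -> : hfun f beta = gfun f + (beta / 4) *: penalty by apply/funext.
apply/matrixP => i j; rewrite [LHS]mxE diffD//; last exact: differentiableZ.
rewrite /= diffZ//= eg eP -[RHS]mxdot_delta.
set D := delta_mx i j.
rewrite mxdotDl mxdotBl /L mxdotBr mxdotZl [beta / 4 *: _]mulrA divfK//.
congr (_ - _ + _).
  by rewrite mxdot_mulmxr tr_Amap.
by rewrite mxdot_mulmxl mxdot_symPhi mxdotC mxdot_mulmxl mxdotC.
Qed.

End gradient.
End differentiation.

(** * Locally Lipschitz maps on bounded sets *)

Section boundedness.
Variable R : realType.

(** Flattened to row vectors, the Frobenius ball sits in a compact cube; compactness merges the
    local bounds into one. *)
Lemma locLip_mx_bounded n p (F : 'M[R]_(n, p) -> 'M[R]_(n, p)) (r : R) :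
  locLip_mx F -> exists C, forall X, frob X <= r -> frob (F X) <= C.
Proof.
move=> lipF.
pose K := [set v : 'rV[R]_(n * p) | forall i, `[- r, r]%classic (v ord0 i)].
have cK : compact K 
  by apply: (@rV_compact _ _ (fun=> `[- r, r]%classic)) => i; exact: segment_compact.
have /compact_near_coveringP cov := cK.
have : \forall C \near +oo, K `<=` (fun v => frob (F (vec_mx v)) <= C).
  apply: (cov _ _ (fun C v => frob (F (vec_mx v)) <= C)) => v _.
  have [e e0 [k lipk]] := lipF (vec_mx v).
  (* [c] converts the entrywise maximum into [frob]; the added 1 keeps it positive when [n * p] is
     zero. *)
  pose c := (n * p)%:R + 1 : R.
  have c0 : 0 < c by rewrite ltr_wpDl.
  exists (ball v (e / c), [set C | frob (F (vec_mx v)) + `|k| * e <= C]) => /=.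
    split; first by apply/nbhs_ballP; exists (e / c) => //=; rewrite divr_gt0.
    exact: (nbhs_pinfty_ge (num_real _)).
  move=> [w C] /= [vw]; apply: le_trans.
  have vwe : frob (vec_mx w - vec_mx v : 'M[R]_(n, p)) < e.
    rewrite -linearB; apply: (@le_lt_trans _ _ (c * `|w - v|)).
      apply: le_trans (frob_le_mx_norm _) _.
      apply: ler_pM => //; first by rewrite lerDl.
      rewrite [leLHS]/Num.Def.normr /= mx_normrE; apply: bigmax_le => // -[i j] _ /=.
      by rewrite mxE mx_norm_ge.
    rewrite mulrC -ltr_pdivlMr//.
    by move: vw; rewrite mx_norm_ball /ball_ /= distrC.
  have := lipk (vec_mx w) (vec_mx v) vwe; rewrite subrr -[X in frob X](scale0r (F 0)).
  rewrite frobZ normr0 mul0r => /(_ e0) h.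
  rewrite -[F (vec_mx w)](subrK (F (vec_mx v))) (le_trans (frobD _ _))// addrC lerD2l.
  rewrite (le_trans h)// (le_trans (ler_wpM2r (frob_ge0 _) (ler_norm k)))//.
  by rewrite ler_wpM2l// ltW.
move=> /filter_ex [C KC]; exists C => X Xr.
rewrite -[X]mxvecK; apply: KC => i /=; rewrite in_itv /= -ler_norml.
case/mxvec_indexP: i => i j; rewrite mxvecE.
by rewrite (le_trans (mx_norm_ge _ _ _))// (le_trans (mx_norm_le_frob _)).
Qed.

End boundedness.

(** * Extreme singular values as bounds on products, and finiteness of [M1] *)

Section singular_values.
Variable R : realType.
Variables n p : nat.
Implicit Types X : 'M[R]_(n, p).

Lemma tr_gram X : (X^T *m X)^T = X^T *m X.
Proof. by rewrite trmx_mul trmxK. Qed.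

Lemma mxdot_gram k X (B : 'M[R]_(k, p)) :
  mxdot B (B *m (X^T *m X)) = frob (B *m X^T) ^+ 2.
Proof. by rewrite frob_sqr mxdot_mulmxr trmxK mulmxA. Qed.

Lemma mxdot_rows k m (A B : 'M[R]_(k, m)) :
  mxdot A B = \sum_i mxdot (row i A) (row i B).
Proof.
rewrite mxdotE -(pair_bigA _ (fun i j => A i j * B i j)) /=.
apply: eq_bigr => i _; rewrite mxdotE.
rewrite -(pair_bigA _ (fun k j => row i A k j * row i B k j)) /= big_ord1.
by apply: eq_bigr => j _; rewrite !mxE.
Qed.

(** An eigenvector [v] satisfies [l |v|^2 = |v X^T|^2]. The upper bound makes the set of singular
    values bounded. *)
Lemma gram_eigenvalue_ge0 X l : eigenvalue (X^T *m X) l -> 0 <= l <= frob X ^+ 2.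
Proof.
move=> /eigenvalueP [v vS v0].
have := mxdot_gram X v; rewrite vS mxdotZr => e.
apply/andP; split; first by rewrite -(pmulr_lge0 _ (mxdot_gt0 v0)) e sqr_ge0.
rewrite -(ler_pM2r (mxdot_gt0 v0)) e -frob_sqr -exprMn.
rewrite ler_pXn2r ?nnegrE ?mulr_ge0 ?frob_ge0//.
by rewrite mulrC (le_trans (frobM _ _))// frob_tr.
Qed.

(** Take [l] the least eigenvalue of [X^T X]: its root is a singular value, hence above the infimum,
    and its bound on row vectors is summed over the rows of [B]. *)
Lemma sigma_min_gram X : (0 < p)%N ->
  exists l, [/\ 0 <= l, sigma_min X <= Num.sqrt l &
    forall k (B : 'M[R]_(k, p)), l * frob B ^+ 2 <= frob (B *m X^T) ^+ 2].
Proof.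
move=> p0; have [l Sl hl] := symmetric_min_eigenvalue p0 (tr_gram X).
exists l; split; first by case/andP: (gram_eigenvalue_ge0 Sl).
  apply: ge_inf; last by exists l.
  by exists 0 => _ [m _ ->]; exact: sqrtr_ge0.
move=> k B; rewrite -mxdot_gram frob_sqr !mxdot_rows mulr_sumr.
by apply: ler_sum => i _; rewrite row_mul hl.
Qed.

(** The largest eigenvalue of [X^T X] is minus the least one of its opposite; its root is a singular
    value, hence below the supremum. *)
Lemma spec_norm_gram X : (0 < p)%N ->
  forall k (B : 'M[R]_(k, p)), frob (B *m X^T) <= spec_norm X * frob B.
Proof.
move=> p0 k B.
have symNS : (- (X^T *m X))^T = - (X^T *m X) by rewrite linearN /= tr_gram.
have [l /eigenvalueP[v vS v0] hl] := symmetric_min_eigenvalue p0 symNS.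
have Sl : eigenvalue (X^T *m X) (- l).
  by apply/eigenvalueP; exists v => //; rewrite scaleNr -vS mulmxN opprK.
have sl : Num.sqrt (- l) <= spec_norm X.
  apply: ub_le_sup; last by exists (- l).
  exists (frob X) => _ [m /gram_eigenvalue_ge0 /andP[_ mX] ->].
  by rewrite -[leRHS]ger0_norm ?frob_ge0// -sqrtr_sqr ler_wsqrtr.
have s0 : 0 <= spec_norm X by apply: le_trans sl; exact: sqrtr_ge0.
rewrite -(ler_pXn2r (n := 2))// ?nnegrE ?mulr_ge0 ?frob_ge0//.
apply: (@le_trans _ _ (- l * frob B ^+ 2)).
  rewrite -mxdot_gram frob_sqr !mxdot_rows mulr_sumr.
  apply: ler_sum => i _; rewrite mulNr lerNr.
  by rewrite row_mul -mxdotNr -mulmxN hl.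
rewrite exprMn ler_wpM2r ?sqr_ge0//.
have /andP[l0 _] := gram_eigenvalue_ge0 Sl.
by rewrite -(sqr_sqrtr l0) ler_pXn2r// nnegrE sqrtr_ge0.
Qed.

Lemma spec_norm_mulmx X : (0 < p)%N ->
  forall k (B : 'M[R]_(p, k)), frob (X *m B) <= spec_norm X * frob B.
Proof.
by move=> p0 k B; rewrite -frob_tr trmx_mul -(frob_tr B) spec_norm_gram.
Qed.

(** A [sup] bounds its set only if that set is bounded above, so a bound for [Gfun f] on [Omega] is
    produced first. *)
Lemma frob_Gfun_le_M1 (f : 'M[R]_(n, p) -> R) X : (0 < p)%N ->
  locLip_mx (mgrad f) -> Omega n p X -> frob (Gfun f X) <= M1 f.
Proof.
move=> p0 lipf OX; apply: ub_le_sup; last by exists X.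
(* [c] bounds [frob Y] on [Omega], by writing [Y] as [Y *m 1]; the radius below then bounds
   [Y *m Amap Y], with the factor 1/2 on [Y^T Y] dropped. *)
pose c := (1 + 12^-1) * frob (1%:M : 'M[R]_p).
have [C fC] := locLip_mx_bounded (c * (frob ((3 / 2 : R)%:M : 'M[R]_p) + c ^+ 2)) lipf.
exists C => _ [Y OY <-]; apply: fC.
have Yc : frob Y <= c.
  rewrite -[Y]mulmx1 (le_trans (spec_norm_mulmx _ _ _))//.
  by rewrite ler_wpM2r ?frob_ge0.
rewrite (le_trans (frobM _ _))// ler_pM ?frob_ge0//.
rewrite (le_trans (frobB _ _))// lerD2l frobZ ger0_norm ?invr_ge0//.
rewrite ler_pdivrMl//.
have := frobM Y^T Y; rewrite frob_tr; have := frob_ge0 Y; nra.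
Qed.

End singular_values.

(** * Critical points with large [sigma_min] are feasible *)

Section stationarity.
Variables (R : realType) (n p : nat).

(* S = X^T X commutes with A(X), so pairing with X (S - 1) makes the gradient
   terms collapse to - 3/2 <G, X (S - 1)^2>. *)
Lemma stationary_pairing (X G : 'M[R]_(n, p)) (beta : R) :
  let N := X^T *m X - 1%:M in
  G *m Amap X - X *m symPhi (X^T *m G) + beta *: (X *m N) = 0 ->
  beta * frob (X *m N) ^+ 2 = 3 / 2 * mxdot (G *m N) (X *m N).
Proof.
set S := X^T *m X => N /(congr1 (fun H => mxdot H (X *m N))).
rewrite mxdot0l mxdotDl mxdotBl mxdotZl -frob_sqr.
have symN : N^T = N by rewrite linearB /= tr_gram trmx1.
have symSN : symPhi (S *m N) = S *m N.
  rewrite /symPhi trmx_mul symN tr_gram -/S /N mulmxBl mulmxBr mulmx1 mul1mx.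
  by apply/matrixP => i j; generalize (S *m S) S => *; rewrite !mxE; field.
have -> : mxdot (G *m Amap X) (X *m N) = mxdot G (X *m (N *m Amap X)).
  by rewrite mxdot_mulmxr tr_Amap mulmxA.
have -> : mxdot (X *m symPhi (X^T *m G)) (X *m N) = mxdot G (X *m (S *m N)).
  by rewrite mxdot_mulmxl mulmxA -/S mxdot_symPhi symSN mxdot_mulmxl trmxK.
rewrite -mxdotBr -mulmxBr.
(* [Amap X - S] equals -3/2 times [N], and everything here is a polynomial in [S]. *)
have -> : N *m Amap X - S *m N = - (3 / 2) *: (N *m N).
  rewrite /Amap /N -/S !(mulmxBl, mulmxBr) !(mulmx1, mul1mx) mul_mx_scalar.
  rewrite -!scalemxAr; generalize (S *m S) S (1%:M : 'M[R]_p) => *.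
  by apply/matrixP => i j; rewrite !mxE; field.
rewrite -scalemxAr mxdotZr mulmxA.
have -> : mxdot G (X *m N *m N) = mxdot (G *m N) (X *m N).
  by rewrite mxdot_mulmxr symN.
lra.
Qed.

(** If [N] were nonzero, [2 m |N|^2 < beta l |N|^2 <= beta |X N|^2 = 3/2 <G N, X N> <= 13/8 m
    |N|^2], which contradicts [m >= 0]. *)
Lemma stationary_feasible (X G : 'M[R]_(n, p)) (beta m : R) :
  (0 < p)%N -> 0 < beta -> spec_norm X <= 1 + 12^-1 -> frob G <= m ->
  Num.sqrt (2 * m / beta) < sigma_min X ->
  G *m Amap X - X *m symPhi (X^T *m G) + beta *: (X *m (X^T *m X - 1%:M)) = 0 ->
  X^T *m X = 1%:M.
Proof.
move=> p0 b0 X1 Gm sX /stationary_pairing /=; set N := X^T *m X - 1%:M.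
have symN : N^T = N by rewrite linearB /= tr_gram trmx1.
have [l [l0 sl hl]] := sigma_min_gram X p0.
(* By symmetry of [N], [N *m X^T] is the transpose of [X *m N]. *)
have := hl _ N; rewrite -(frob_tr (N *m X^T)) trmx_mul trmxK symN.
have m0 : 0 <= m by apply: le_trans Gm; exact: frob_ge0.
have ml : 2 * m < beta * l.
  have sml := lt_le_trans sX sl.
  have l_gt0 : 0 < l by rewrite -sqrtr_gt0 (le_lt_trans (sqrtr_ge0 _) sml).
  by rewrite (mulrC beta) -ltr_pdivrMr// -ltr_sqrt.
have := mxdot_le (G *m N) (X *m N).
have := frobM G N; have := spec_norm_mulmx X p0 N.
have := frob_ge0 (G *m N); have := frob_ge0 (X *m N); have := frob_ge0 N.
set a := frob N; set x := frob (X *m N); set y := frob (G *m N); set d := mxdot _ _.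
move=> a0 x0 y0 xa ya dxy la e.
suff /frob_eq0 /eqP : a = 0 by rewrite subr_eq0 => /eqP.
apply/eqP; rewrite eq_le a0 andbT leNgt; apply/negP => a_gt0.
have xa' : x <= 13 / 12 * a.
  by apply: le_trans xa _; rewrite ler_wpM2r//; move: X1; lra.
have ya' : y <= m * a by apply: le_trans ya _; rewrite ler_wpM2r.
have d2 : d <= m * a * (13 / 12 * a) by apply: le_trans dxy _; rewrite ler_pM.
have a2 : 0 < a ^+ 2 by rewrite exprn_gt0.
have h1 : beta * (l * a ^+ 2) <= beta * x ^+ 2 by rewrite ler_pM2l.
have h2 : 2 * m * a ^+ 2 < beta * l * a ^+ 2 by rewrite ltr_pM2r.
have h3 : 0 <= m * a ^+ 2 by rewrite mulr_ge0 ?sqr_ge0.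
by move: d2; rewrite (_ : m * a * _ = 13 / 12 * (m * a ^+ 2)); [lra|ring].
Qed.

End stationarity.

Theorem mainTheorem7 (R : realType) (n p : nat) (f : 'M[R]_(n, p) -> R)
  (beta : R) (Xs : 'M[R]_(n, p)) :
  (p <= n)%N ->
  (forall X, differentiable f X) ->
  locLip_real f ->
  locLip_mx (mgrad f) ->
  0 < beta ->
  betabar f <= beta ->
  Omega n p Xs ->
  mgrad (hfun f beta) Xs = 0 ->
  (Xs^T *m Xs = 1%:M /\ gradOCP f Xs = 0) \/
  sigma_min Xs <= Num.sqrt (2 * M1 f / beta).
Proof.
move=> _ df _ lipf b0 _ OX; rewrite mgrad_hfun// => gh.
(* For [p = 0] the matrices have no entries and the first alternative holds; the eigenvalue
   arguments need [p > 0]. *)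
have [p0|p0] := posnP p.
  left; split; apply/matrixP => i j; suff: False by [].
    by case: i => k; rewrite p0.
  by case: j => k; rewrite p0.
have [|sX] := leP (sigma_min Xs); [by right|left].
have X1 : Xs^T *m Xs = 1%:M.
  exact: stationary_feasible p0 b0 OX (frob_Gfun_le_M1 p0 lipf OX) sX gh.
split=> //; move: gh.
have A1 : Amap Xs = 1%:M.
  by rewrite /Amap X1; apply/matrixP => i j; rewrite !mxE; case: (i == j) => /=; field.
by rewrite /Gfun A1 !mulmx1 X1 subrr mulmx0 scaler0 addr0.
Qed.
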